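(* Let $T$ be an automorphism of a measurable space $(X,\mathcal F)$, let $\xi$ be a countable measurable partition of $X$ and let $\mu$ be a $T$-invariant probability measure such that the entropy $H_\mu(\xi)$ is finite. Assume that there exist a sequence of $T$-invariant probability measures $\mu_n$ ($n\ge 1$) and sequences of numbers $r_n\in\mathbb N$, $\varepsilon_n>0$ such that (i) $\lim_{n\to\infty} r_n=\infty$ and $\lim_{n\to\infty}\varepsilon_n=0$; (ii) $|\mu(A)-\mu_n(A)|\le \varepsilon_n\mu_n(A)$ for all $n\ge 1$ and all atoms $A$ of the partition $\bigvee_{i=0}^{r_n}T^{-i}\xi$; (iii) $\xi$ is a generator for $(T,\mu)$ and for $(T,\mu_n)$, for every $n\ge 1$. Then $$h_\mu(T)\ge\limsup_{n\to\infty}h_{\mu_n}(T).$$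
   Context: An automorphism $T$ of a measurable space $(X,\mathcal F)$ is an invertible map $X\to X$ that is measurable together with its inverse. All measures are defined on $\mathcal F$. For a countable measurable partition $\eta$ and a probability measure $\mu$, $H_\mu(\eta)=-\sum_{B}\mu(B)\ln\mu(B)$ (sum over the atoms $B$ of $\eta$, with $0\ln 0=0$). $h_\mu(T)$ denotes the Kolmogorov--Sinai entropy of $T$ with respect to the $T$-invariant probability measure $\mu$ (possibly $+\infty$). $\bigvee$ denotes the common refinement (join) of partitions. A countable measurable partition $\eta$ is called a generator (generating partition) for $(T,\mu)$ if the $\sigma$-algebra generated by the partitions $T^i\eta$, $i\in\mathbb Z$, coincides with $\mathcal F$ modulo $\mu$-null sets. *)

(* Defs.v *)
From HB Require Import structures.
From mathcomp Require Import all_boot all_order all_algebra.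
From mathcomp Require Import all_classical all_reals all_analysis.
Set Implicit Arguments.
Unset Strict Implicit.
Unset Printing Implicit Defensive.
Import Order.TTheory GRing.Theory Num.Theory.
Import numFieldNormedType.Exports.

Local Open Scope classical_set_scope.
Local Open Scope ring_scope.

Section Entropy.
Context {d : measure_display} {X : measurableType d} {R : realType}.

Definition measurable_automorphism (T : X -> X) : Prop :=
  measurable_fun setT T /\
  exists S : X -> X, [/\ measurable_fun setT S, cancel T S & cancel S T].

Definition invariant_measure (T : X -> X) (mu : probability X R) : Prop :=
  forall A : set X, measurable A -> mu (T @^-1` A) = mu A.

(* A partition is the set of its atoms; atoms are nonempty. *)
Definition countable_partition (eta : set (set X)) : Prop :=
  [/\ countable eta, eta `<=` measurable & partition eta id setT].

Definition partition_entropy (mu : probability X R) (eta : set (set X)) :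
    \bar R :=
  \esum_(B in eta) (- (fine (mu B) * ln (fine (mu B))))%:E.

Definition partition_join (eta zeta : set (set X)) : set (set X) :=
  [set A `&` B | A in eta & B in zeta] `\ set0.

(* For invertible T this is T^i eta: images of the atoms when i >= 0,
   preimages under T^(-i) when i < 0. *)
Definition partition_shift (T : X -> X) (i : int) (eta : set (set X)) :
    set (set X) :=
  match i with
  | Posz n => [set iter n T @` A | A in eta]
  | Negz n => [set iter n.+1 T @^-1` A | A in eta]
  end.

(* The join of T^{-i} eta over 0 <= i < n; [set setT] is the trivial partition. *)
Definition iterated_join (T : X -> X) (eta : set (set X)) (n : nat) :
    set (set X) :=
  \big[partition_join/[set setT]]_(i < n) partition_shift T (- i%:Z) eta.

Definition entropy_wrt (mu : probability X R) (T : X -> X)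
    (eta : set (set X)) : \bar R :=
  limn (fun n : nat =>
    ((n%:R^-1)%:E * partition_entropy mu (iterated_join T eta n))%E).

(* The Kolmogorov-Sinai entropy, with the supremum over the countable
   measurable partitions of finite entropy. *)
Definition ks_entropy (mu : probability X R) (T : X -> X) : \bar R :=
  ereal_sup [set entropy_wrt mu T eta | eta in
    [set eta | countable_partition eta /\ (partition_entropy mu eta < +oo)%E]].

(* The generated sigma-algebra consists of measurable sets, so only one
   inclusion modulo null sets has to be required. *)
Definition generating_partition (T : X -> X) (mu : probability X R)
    (eta : set (set X)) : Prop :=
  forall B : set X, measurable B ->
  exists C : set X,
    <<s \bigcup_(i in [set: int]) partition_shift T i eta >> C /\
    mu (B `+` C) = 0%E.

End Entropy.

(* Main.v *)
Require Import Defs.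
From HB Require Import structures.
From mathcomp Require Import all_boot all_order all_algebra.
From mathcomp Require Import all_classical all_reals all_analysis.
From mathcomp Require Import zify ring lra.
Set Implicit Arguments.
Unset Strict Implicit.
Unset Printing Implicit Defensive.
Import Order.TTheory GRing.Theory Num.Theory.
Import numFieldNormedType.Exports.
Local Open Scope classical_set_scope.
Local Open Scope ring_scope.

(* Write xi^k for the join of T^{-i} xi over 0 <= i < k. By the Kolmogorov-Sinai
   theorem h_{mu_n}(T) = h_{mu_n}(T, xi), and by subadditivity this is at most
   H_{mu_n}(xi^k) / k for every k >= 1. Once r_n + 1 >= k, the closeness
   hypothesis passes to the atoms of xi^k and gives
     H_{mu_n}(xi^k) <= H_mu(xi^k) / (1 - eps_n) + ln (1 + eps_n).
   Letting n tend to infinity and then k, the limsup is at most h_mu(T, xi).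
   The Kolmogorov-Sinai theorem rests on H(eta | joins of T^i xi, |i| <= N) -> 0:
   each atom of eta is approximated by a union B of atoms of such a join, and
   the log-sum inequality applied on B and on its complement bounds the
   contribution of that atom by the measure of the symmetric difference. *)

(** * Sums of nonnegative extended reals over arbitrary index sets *)

Section ExtendedSums.
Context {R : realType}.
Local Open Scope ereal_scope.

Lemma esumZl (I : choiceType) (A : set I) (a : I -> \bar R) (c : R) :
  (0 <= c)%R -> (forall i, 0 <= a i) ->
  \esum_(i in A) (c%:E * a i) = c%:E * \esum_(i in A) a i.
Proof.
move=> c0 a0; rewrite /esum -ereal_supZl//; last first.
  by apply/set0P; exists (\sum_(i \in set0) a i); exists set0 => //; exact: fsets_set0.
congr ereal_sup; apply/seteqP; split => x /=.
  move=> [B [finB BA] <-]; exists (\sum_(i \in B) a i); first by exists B.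
  by rewrite ge0_mule_fsumr.
move=> [_ [B [finB BA] <-] <-]; exists B => //.
by rewrite ge0_mule_fsumr.
Qed.

Lemma esum_fibers (I J : choiceType) (phi : I -> J) (a : I -> \bar R) :
  (forall i, 0 <= a i) ->
  \esum_(i in setT) a i =
  \esum_(j in setT) \esum_(i in phi @^-1` [set j]) a i.
Proof.
move=> a0; rewrite esum_esum//; apply: reindex_esum; split => //=.
- by move=> [j i] [j' i'] /=; rewrite !inE/= => -[_ <-] [_ <-] ->.
- by move=> i _; exists (phi i, i).
Qed.

Lemma sube_esum (I : choiceType) (A B : set I) (a : I -> \bar R) :
  A `<=` B -> (forall i, 0 <= a i) ->
  \esum_(i in A) a i <= \esum_(i in B) a i.
Proof.
move=> AB a0; rewrite esum_mkcond [leRHS]esum_mkcond; apply: le_esum => i _.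
by case: ifPn; case: ifPn => // /negP iB iA; case: iB; move: iA; rewrite !inE; exact: AB.
Qed.

Lemma esum_ge_term (I : choiceType) (A : set I) (a : I -> \bar R) i :
  A i -> (forall j, 0 <= a j) -> a i <= \esum_(j in A) a j.
Proof.
by move=> Ai a0; rewrite -(@esum_set1 _ _ i)//; apply: sube_esum => // _ ->.
Qed.

End ExtendedSums.

(** * The entropy summand [psi] and the log-sum inequality *)

Section LogSum.
Context {R : realType}.

(* The contribution [- m ln (m / c)] of an event of probability [m] inside an
   atom of probability [c] to a conditional entropy. *)
Definition psi (m c : R) : R := m * ln (c / m).

Lemma psi0 c : psi 0 c = 0. Proof. by rewrite /psi mul0r. Qed.

Lemma psixx m : psi m m = 0.
Proof.
have [->|m0] := eqVneq m 0; first by rewrite psi0.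
by rewrite /psi divff// ln1 mulr0.
Qed.

Lemma psi_ge0 m c : 0 <= m <= c -> 0 <= psi m c.
Proof.
move=> /andP[]; rewrite le_eqVlt => /predU1P[<- _|m0 mc]; first by rewrite psi0.
by rewrite /psi mulr_ge0 ?(ltW m0)// ln_ge0// ler_pdivlMr// mul1r.
Qed.

(** The chain rule for a single summand: ln (c / m) splits at the intermediate mass [c']. When [m]
    is positive, so are the other two masses; when it is 0, everything vanishes. *)
Lemma psi_chain m c' c : 0 <= m -> m <= c' -> c' <= c ->
  psi m c = m * ln (c / c') + psi m c'.
Proof.
rewrite le_eqVlt => /predU1P[<- _ _|m0 mc cc]; first by rewrite !psi0 mul0r addr0.
have c'0 := lt_le_trans m0 mc; have c0 := lt_le_trans c'0 cc.
rewrite /psi !ln_div ?posrE//; ring.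
Qed.

(* Concavity of [psi] in homogeneous form: [ln y <= y - 1] at [y = c M / (m C)].
   The term [m] is kept on the left so that all summands stay nonnegative. *)
Lemma psi_tangent m c M C : 0 <= m -> m <= c -> 0 < M -> 0 < C ->
  psi m c + m <= m * ln (C / M) + c * (M / C).
Proof.
rewrite le_eqVlt => /predU1P[<- c0 M0 C0|m0 mc M0 C0].
  by rewrite psi0 mul0r !add0r mulr_ge0 ?divr_ge0// ltW.
have c0 := lt_le_trans m0 mc.
have y0 : 0 < c * M / (m * C) by rewrite divr_gt0 ?mulr_gt0.
have ->: psi m c = m * ln (C / M) + m * ln (c * M / (m * C)).
  rewrite /psi -mulrDr -lnM ?posrE ?y0 ?(divr_gt0 C0 M0)//; congr (_ * ln _).
  by field; rewrite !gt_eqF.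
rewrite -addrA lerD2l.
have : ln (c * M / (m * C)) <= c * M / (m * C) - 1.
  have := @le_ln1Dx R (c * M / (m * C) - 1).
  by rewrite subrKC; apply; rewrite ltrBrDr addrC subrr.
rewrite -(ler_pM2l m0) mulrBr mulr1 lerBrDr => /le_trans; apply.
by rewrite le_eqVlt; apply/orP; left; apply/eqP; field; rewrite !gt_eqF.
Qed.

(** Sum [psi_tangent] over the index set with the total masses as parameters: the right side adds up
    to M ln (C / M) + M, and the finite [M] cancels against the sum of the [m i] on the left. If [M]
    is 0, every [m i] vanishes. *)
Lemma log_sum (I : choiceType) (A : set I) (m c : I -> R) (M C : R) :
  (forall i, 0 <= m i <= c i) ->
  (\esum_(i in A) (m i)%:E = M%:E)%E -> (\esum_(i in A) (c i)%:E = C%:E)%E ->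
  (\esum_(i in A) (psi (m i) (c i))%:E <= (psi M C)%:E)%E.
Proof.
move=> mc mM cC.
have m0 i : 0 <= m i by have /andP[] := mc i.
have c0 i : 0 <= c i by have /andP[] := mc i; exact: le_trans.
have M0 : 0 <= M by rewrite -lee_fin -mM; apply: esum_ge0 => i _; rewrite lee_fin.
have MC : M <= C.
  by rewrite -lee_fin -mM -cC; apply: le_esum => i _; rewrite lee_fin; case/andP: (mc i).
have [M_0|M_pos] := eqVneq M 0.
  rewrite M_0 psi0 esum1// => i Ai.
  suff -> : m i = 0 by rewrite psi0.
  apply/eqP; rewrite eq_le m0 andbT -lee_fin -M_0 -mM.
  by apply: (@esum_ge_term _ _ _ (fun i => (m i)%:E)) => // j; rewrite lee_fin.
have {}M_pos : 0 < M by rewrite lt0r M_pos.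
have C_pos := lt_le_trans M_pos MC.
have lCM : 0 <= ln (C / M) by rewrite ln_ge0// ler_pdivlMr// mul1r.
have : (\esum_(i in A) ((psi (m i) (c i))%:E + (m i)%:E) <=
    \esum_(i in A) ((ln (C / M))%:E * (m i)%:E + (M / C)%:E * (c i)%:E))%E.
  apply: le_esum => i _; rewrite -!EFinM -!EFinD lee_fin (mulrC (ln _)) (mulrC (M / C)).
  by apply: psi_tangent => //; case/andP: (mc i).
have MC0 : 0 <= M / C by rewrite divr_ge0// ltW.
rewrite esumD => [|i _|i _]; last 2 first.
- by rewrite lee_fin psi_ge0.
- by rewrite lee_fin.
rewrite esumD => [|i _|i _]; last 2 first.
- by rewrite -EFinM lee_fin mulr_ge0.
- by rewrite -EFinM lee_fin mulr_ge0.
rewrite !esumZl//.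
rewrite mM cC -!EFinM -EFinD divfK ?gt_eqF// EFinD leeD2rE//.
by rewrite /psi mulrC.
Qed.

(** With s the square root of x, -x ln x = 2 s^2 ln (1 / s), and ln y <= y at y = 1 / s. This is an
    explicit modulus of continuity of -x ln x at 0. *)
Lemma psi_le_sqrt x : 0 <= x -> psi x 1 <= 2 * Num.sqrt x.
Proof.
rewrite le_eqVlt => /predU1P[<-|x0]; first by rewrite psi0 mulr_ge0 ?sqrtr_ge0.
set s := Num.sqrt x.
have s0 : 0 < s by rewrite sqrtr_gt0.
have -> : x = s ^+ 2 by rewrite sqr_sqrtr// ltW.
have -> : psi (s ^+ 2) 1 = 2 * (s ^+ 2 * ln (s^-1)).
  by rewrite /psi div1r -exprVn lnXn ?invr_gt0// mulr2n mulrDr; ring.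
rewrite ler_pM2l//.
apply: (@le_trans _ _ (s ^+ 2 * s^-1)).
  by rewrite ler_pM2l ?exprn_gt0// ltW// ln_sublinear// invr_gt0.
by rewrite expr2 mulfK// gt_eqF.
Qed.

End LogSum.

(** * Countable measurable partitions as labellings *)

Section Codes.
Context {d : measure_display} {X : measurableType d}.

(* A countable measurable partition is handled as a labelling of its atoms:
   [f] stands for the partition of [X] into the nonempty fibres of [f]. *)
Definition code (I : Type) (f : X -> I) : Prop :=
  forall k, measurable (f @^-1` [set k]).

Definition pair_code (I J : Type) (f : X -> I) (g : X -> J) (x : X) := (f x, g x).

(** A countable union of fibres; [pickle] turns it into a union indexed by natural numbers. *)
Lemma code_preimage (I : countType) (f : X -> I) (B : set I) :
  code f -> measurable (f @^-1` B).
Proof.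
move=> mf.
have -> : f @^-1` B = \bigcup_(n in [set n | exists2 k, B k & pickle k = n])
    (f @^-1` [set k | pickle k = n]).
  apply/seteqP; split => x /=; first by move=> Bfx; exists (pickle (f x)) => //; exists (f x).
  by move=> [_ [k Bk <-]] /= /(pcan_inj pickleK) e; rewrite /preimage /= e.
apply: bigcup_measurable => n [k Bk <-].
rewrite (_ : [set _ | _] = [set k])//.
by apply/seteqP; split => [i /(pcan_inj pickleK)|i ->].
Qed.

Lemma code_comp (I J : countType) (phi : I -> J) (f : X -> I) :
  code f -> code (phi \o f).
Proof. by move=> mf k; rewrite comp_preimage; exact: code_preimage. Qed.

Lemma pair_code_preimage (I J : Type) (f : X -> I) (g : X -> J) k :
  pair_code f g @^-1` [set k] = f @^-1` [set k.1] `&` g @^-1` [set k.2].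
Proof.
by case: k => a b; apply/seteqP; split => x /= => [[<- <-]|[<- <-]].
Qed.

Lemma code_pair (I J : Type) (f : X -> I) (g : X -> J) :
  code f -> code g -> code (pair_code f g).
Proof. by move=> mf mg k; rewrite pair_code_preimage; exact: measurableI. Qed.

Lemma code_cst (I : Type) (a : I) : code (fun _ : X => a).
Proof.
move=> k; have [->|ak] := pselect (a = k).
  by rewrite (_ : _ @^-1` _ = setT)//; apply/seteqP.
by rewrite (_ : _ @^-1` _ = set0)//; apply/seteqP; split.
Qed.

Lemma code_measurable_comp (I : Type) (f : X -> I) (T : X -> X) :
  measurable_fun setT T -> code f -> code (f \o T).
Proof. by move=> mT mf k; rewrite comp_preimage -[X in measurable X]setTI; exact: mT. Qed.

End Codes.

(** * Conditional entropy of labellings and its laws *)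

Section ConditionalEntropy.
Context {d : measure_display} {X : measurableType d} {R : realType}.
Variable P : probability X R.

Definition pr (A : set X) : R := fine (P A).

Lemma prE A : measurable A -> (pr A)%:E = P A.
Proof. by move=> mA; rewrite /pr fineK// fin_num_measure. Qed.

Lemma pr_ge0 A : 0 <= pr A. Proof. exact: fine_ge0. Qed.

Lemma pr_setT : pr setT = 1. Proof. by rewrite /pr probability_setT. Qed.

Lemma le_pr A B : measurable A -> measurable B -> A `<=` B -> pr A <= pr B.
Proof. by move=> mA mB AB; rewrite -lee_fin !prE// le_measure ?inE. Qed.

Lemma pr_le1 A : measurable A -> pr A <= 1.
Proof. by move=> mA; rewrite -lee_fin prE// probability_le1. Qed.

Lemma prU A B : measurable A -> measurable B -> pr (A `|` B) <= pr A + pr B.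
Proof.
move=> mA mB; rewrite -lee_fin EFinD !prE//; last exact: measurableU.
exact: measureU2.
Qed.

(** Countable additivity over the fibres of [f], carried to a series over the naturals by
    [pickle]. *)
Lemma pr_esum (I : countType) (f : X -> I) (B : set I) (E : set X) :
  code f -> measurable E ->
  (\esum_(k in B) (pr (E `&` f @^-1` [set k]))%:E)%E = P (E `&` f @^-1` B).
Proof.
move=> mf mE.
have mfE k : measurable (E `&` f @^-1` [set k]) by exact: measurableI.
pose D := [set n | exists2 k, B k & pickle k = n].
pose F n := E `&` f @^-1` [set k | pickle k = n].
have FE k : F (pickle k) = E `&` f @^-1` [set k].
  rewrite /F (_ : [set _ | _] = [set k])//.
  by apply/seteqP; split => [i /(pcan_inj pickleK)|i ->].
have -> : E `&` f @^-1` B = \bigcup_(n in D) F n.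
  apply/seteqP; split => x /=.
    by move=> [Ex Bfx]; exists (pickle (f x)) => //; exists (f x).
  by move=> [_ [k Bk <-]] /=; rewrite FE => -[Ex /= ->].
rewrite measure_bigcup//; last 2 first.
- by move=> _ [k _ <-]; rewrite FE.
- by move=> i j _ _ [x [[_ /= <-] [_ /= <-]]].
rewrite nneseries_esum// (_ : [set _ | _] = [set pickle k | k in B]); last first.
  by apply/seteqP; split => n /=; rewrite inE /D /=.
rewrite esum_image; last by move=> a b _ _ /(pcan_inj pickleK).
by apply: eq_esum => k Bk; rewrite FE prE.
Qed.

Lemma pr_esumT (I : countType) (f : X -> I) (B : set I) :
  code f -> (\esum_(k in B) (pr (f @^-1` [set k]))%:E)%E = P (f @^-1` B).
Proof.
move=> mf; rewrite -[X in P X]setTI -pr_esum//.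
by apply: eq_esum => k _; rewrite setTI.
Qed.

(** Change of variables for the image law. It allows a sum over coarse atoms to be compared term by
    term with one over finer atoms. *)
Lemma esum_marginal (I J : countType) (f : X -> I) (phi : I -> J) (u : J -> R) :
  code f -> (forall j, 0 <= u j) ->
  (\esum_(j in setT) (pr ((phi \o f) @^-1` [set j]) * u j)%:E =
   \esum_(i in setT) (pr (f @^-1` [set i]) * u (phi i))%:E)%E.
Proof.
move=> mf u0; rewrite [RHS](esum_fibers phi); last first.
  by move=> i; rewrite lee_fin mulr_ge0 ?pr_ge0.
apply: eq_esum => j _; rewrite EFinM muleC prE; last exact: code_comp.
rewrite comp_preimage -pr_esumT// -esumZl//; last by move=> i; rewrite lee_fin pr_ge0.
by apply: eq_esum => i /= ->; rewrite EFinM muleC.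
Qed.

(** This is H(f | g). For codes all summands are nonnegative, so the sum makes sense in the extended
    reals without a finiteness hypothesis. *)
Definition cond_entropy (I J : countType) (f : X -> I) (g : X -> J) : \bar R :=
  (\esum_(k in [set: I * J])
    (psi (pr (pair_code f g @^-1` [set k])) (pr (g @^-1` [set k.2])))%:E)%E.

(** Conditioning on the one-atom partition, so that the laws of conditional entropy specialise
    directly. *)
Definition entropy (I : countType) (f : X -> I) : \bar R :=
  cond_entropy f (fun=> tt).

Section Laws.
Variables (I J K : countType) (f : X -> I) (g : X -> J) (h : X -> K).
Hypotheses (mf : code f) (mg : code g) (mh : code h).

Lemma le_pair_pr k : 0 <= pr (pair_code f g @^-1` [set k]) <= pr (g @^-1` [set k.2]).
Proof.
rewrite pr_ge0 le_pr//; first exact: code_pair.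
by rewrite pair_code_preimage; exact: subIsetr.
Qed.

Lemma psi_pair_ge0 k :
  0 <= psi (pr (pair_code f g @^-1` [set k])) (pr (g @^-1` [set k.2])).
Proof. by rewrite psi_ge0// le_pair_pr. Qed.

Lemma cond_entropy_ge0 : (0 <= cond_entropy f g)%E.
Proof. by apply: esum_ge0 => k _; rewrite lee_fin psi_pair_ge0. Qed.

Lemma cond_entropyE : cond_entropy f g =
  (\esum_(a in setT) \esum_(b in setT)
    (psi (pr (f @^-1` [set a] `&` g @^-1` [set b])) (pr (g @^-1` [set b])))%:E)%E.
Proof.
rewrite esum_esum; last first.
  move=> a b _ _; rewrite lee_fin.
  by have := psi_pair_ge0 (a, b); rewrite pair_code_preimage.
rewrite /cond_entropy (_ : _ `*`` _ = setT); last by apply/seteqP.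
by apply: eq_esum => k _; rewrite pair_code_preimage.
Qed.

(** The chain rule H(f, h | g) = H(f | g) + H(h | f, g). Once all three terms are sums over the
    joint atoms of f, h and g, it is [psi_chain] termwise, with the joint atom of f and g in the
    middle. *)
Lemma cond_entropy_pair :
  cond_entropy (pair_code f h) g =
  (cond_entropy f g + cond_entropy h (pair_code f g))%E.
Proof.
pose F := pair_code (pair_code f h) g.
have mF : code F by apply: code_pair => //; exact: code_pair.
pose phi (k : (I * K) * J) := (k.1.1, k.2).
pose u k := ln (pr (g @^-1` [set k.2]) / pr (pair_code f g @^-1` [set k])).
have u0 k : 0 <= u k.
  (* On null atoms the conventions 0^-1 = 0 and ln 0 = 0 make [u] vanish. *)
  rewrite /u; have /andP[] := le_pair_pr k; rewrite le_eqVlt => /predU1P[<-|p0 pg].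
    by rewrite invr0 mulr0 ln0.
  by rewrite ln_ge0// ler_pdivlMr// mul1r.
have -> : cond_entropy f g =
    (\esum_(k in setT) (pr (F @^-1` [set k]) * u (phi k))%:E)%E.
  by rewrite -esum_marginal.
have -> : cond_entropy h (pair_code f g) = (\esum_(k in setT)
    (psi (pr (F @^-1` [set k])) (pr (pair_code f g @^-1` [set phi k])))%:E)%E.
  rewrite /cond_entropy.
  rewrite (@reindex_esum _ _ _ setT setT
    (fun k : (I * K) * J => (k.1.2, (k.1.1, k.2)))); last first.
    split => //=; first by move=> [[? ?] ?] [[? ?] ?] _ _ [-> -> ->].
    by move=> [c [a b]] _; exists ((a, c), b).
  apply: eq_esum => -[[a c] b] _ /=.
  rewrite /F !pair_code_preimage/= setICA.
  by rewrite -setIA setICA setIA.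
rewrite -esumD; last 2 first.
- by move=> k _; rewrite lee_fin mulr_ge0 ?pr_ge0.
- move=> k _; rewrite lee_fin psi_ge0// pr_ge0 le_pr//; first exact: code_pair.
  by rewrite /F /phi; move: k => -[[a c] b] x /= [<- _ <-].
apply: eq_esum => k _; rewrite -EFinD; congr (_%:E).
rewrite (psi_chain (c' := pr (pair_code f g @^-1` [set phi k])))//.
- exact: pr_ge0.
- rewrite le_pr//; first exact: code_pair.
  by rewrite /F /phi; move: k => -[[a c] b] x /= [<- _ <-].
- by have /andP[] := le_pair_pr (phi k).
Qed.

(** Written over the fine atoms, the coarse sum has the same weights but smaller logarithms, since
    merging labels only increases the mass inside the logarithm's denominator. *)
Lemma cond_entropy_comp_le (phi : I -> K) :
  (cond_entropy (phi \o f) g <= cond_entropy f g)%E.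
Proof.
pose Phi (k : I * J) := (phi k.1, k.2).
pose fg := pair_code f g.
pose m (k : K * J) := pr (pair_code (phi \o f) g @^-1` [set k]).
have mfg : code fg by exact: code_pair.
have mpfg : code (pair_code (phi \o f) g) by apply: code_pair => //; exact: code_comp.
have le_m k : 0 <= m k <= pr (g @^-1` [set k.2]).
  rewrite pr_ge0 le_pr//.
  by rewrite pair_code_preimage; exact: subIsetr.
have -> : cond_entropy (phi \o f) g = (\esum_(k in setT) (pr (fg @^-1` [set k]) *
     ln (pr (g @^-1` [set k.2]) / m (Phi k)))%:E)%E.
  rewrite -(@esum_marginal _ _ fg Phi (fun k => ln (pr (g @^-1` [set k.2]) / m k)))//.
  move=> k; have /andP[] := le_m k; rewrite le_eqVlt => /predU1P[<-|p0 pg].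
    by rewrite invr0 mulr0 ln0.
  by rewrite ln_ge0// ler_pdivlMr// mul1r.
apply: le_esum => k _; rewrite lee_fin.
have := pr_ge0 (fg @^-1` [set k]); rewrite le_eqVlt => /predU1P[e|p0].
  by rewrite -e mul0r psi0.
rewrite /psi ler_pM2l//.
have pm : pr (fg @^-1` [set k]) <= m (Phi k).
  rewrite le_pr//.
  by rewrite /fg /Phi; move: k {p0} => -[a b] x /= [<- <-].
have m0 := lt_le_trans p0 pm.
have g0 : 0 < pr (g @^-1` [set k.2]).
  by apply: lt_le_trans m0 _; have /andP[] := le_m (Phi k).
rewrite ler_ln ?posrE ?divr_gt0// ler_pM2l//.
by rewrite lef_pV2.
Qed.

End Laws.

(** Refining the condition lowers entropy: apply the log-sum inequality to the atoms of [f] lying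
    inside one atom of the coarser condition. *)
Lemma cond_entropy_le_comp (I J K : countType) (h : X -> I) (f : X -> J) (phi : J -> K) :
  code h -> code f ->
  (cond_entropy h f <= cond_entropy h (phi \o f))%E.
Proof.
move=> mh mf; have mpf : code (phi \o f) by exact: code_comp.
rewrite !cond_entropyE//; apply: le_esum => a _.
rewrite (esum_fibers phi); last first.
  move=> b; rewrite lee_fin.
  by have := psi_pair_ge0 mh mf (a, b); rewrite pair_code_preimage.
apply: le_esum => c _; apply: log_sum.
- by move=> b; have := le_pair_pr mh mf (a, b); rewrite pair_code_preimage.
- by rewrite pr_esum// prE// ; exact: measurableI.
- by rewrite pr_esumT// prE.
Qed.

Lemma cond_entropy_self (I J : countType) (f : X -> I) (phi : I -> J) :
  cond_entropy (phi \o f) f = 0%E.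
Proof.
apply: esum1 => -[b a] _; congr (_%:E); rewrite pair_code_preimage /=.
have [<-|ba] := pselect (phi a = b).
  rewrite (_ : _ `&` _ = f @^-1` [set a]) ?psixx//.
  by apply/seteqP; split => x /= => [[]|->].
rewrite (_ : _ `&` _ = set0) ?/pr ?measure0 ?psi0//.
by apply/seteqP; split => x //= [fxb fxa]; apply: ba; rewrite -fxb -fxa.
Qed.

Lemma entropy_pair (I J : countType) (f : X -> I) (g : X -> J) :
  code f -> code g ->
  (entropy (pair_code f g) <= entropy f + cond_entropy g f)%E.
Proof.
move=> mf mg; rewrite /entropy cond_entropy_pair//; last exact: code_cst.
rewrite leeD2l//.
by apply: (@cond_entropy_le_comp _ _ _ g (pair_code f (fun=> tt)) (fun k => (k.1)))%E => //;
  apply: code_pair => //; exact: code_cst.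
Qed.

Lemma cond_entropy_le_entropy (I J : countType) (f : X -> I) (g : X -> J) :
  code f -> code g -> (cond_entropy f g <= entropy f)%E.
Proof. by move=> mf mg; exact: (@cond_entropy_le_comp _ _ _ f g (fun=> tt)). Qed.

Lemma cond_entropy_invariant (T : X -> X) (I J : countType) (f : X -> I) (g : X -> J) :
  invariant_measure T P -> code f -> code g ->
  cond_entropy (f \o T) (g \o T) = cond_entropy f g.
Proof.
move=> iT mf mg; apply: eq_esum => k _; congr (psi _ _)%:E; rewrite /pr.
  by rewrite -(iT (pair_code f g @^-1` [set k]))//; exact: code_pair.
by rewrite -(iT (g @^-1` [set k.2])).
Qed.

End ConditionalEntropy.

(** * Words of labels along orbits and their entropy *)

Section Words.
Context {d : measure_display} {X : measurableType d} {R : realType}.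
Variables (T : X -> X) (mT : measurable_fun setT T).

(** The labelling of the join of the first [n] preimages of the partition. Lists give one countable
    label type for all lengths. *)
Definition word (I : Type) (f : X -> I) (n : nat) (x : X) : seq I :=
  [seq f (iter i T x) | i <- iota 0 n].

Lemma size_word (I : Type) (f : X -> I) n x : size (word f n x) = n.
Proof. by rewrite size_map size_iota. Qed.

Lemma word_addn (I : Type) (f : X -> I) m n x :
  word f (m + n) x = word f m x ++ word f n (iter m T x).
Proof.
rewrite /word iotaD map_cat add0n; congr cat.
rewrite -{1}(addn0 m) iotaDl -map_comp; apply: eq_map => i /=.
by rewrite addnC iterD.
Qed.

Lemma wordSr (I : Type) (f : X -> I) n x :
  word f n.+1 x = rcons (word f n x) (f (iter n T x)).
Proof. by rewrite -addn1 word_addn cats1. Qed.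

Lemma measurable_iter n : measurable_fun setT (iter n T).
Proof.
elim: n => [|n IHn]; first exact: measurable_id.
exact: (measurableT_comp mT IHn).
Qed.

Lemma code_iter (I : Type) (f : X -> I) n : code f -> code (f \o iter n T).
Proof. exact/code_measurable_comp/measurable_iter. Qed.

Lemma code_word (I : countType) (f : X -> I) n : code f -> code (word f n).
Proof.
move=> mf; elim: n => [|n IHn]; first exact: code_cst.
rewrite (_ : word f n.+1 = (fun k => rcons k.1 k.2) \o
    pair_code (word f n) (f \o iter n T)).
  by apply: code_comp; apply: code_pair => //; exact: code_iter.
by apply/funext => x; rewrite wordSr.
Qed.

(** A point of the space serves later as a source of default letters, and shows that the trivial
    partition has a nonempty atom. *)
Lemma probability_inhabited (P : probability X R) : [set: X] !=set0.
Proof.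
apply/set0P/eqP => X0; have := probability_setT P.
by rewrite X0 measure0 => /eqP; rewrite eq_sym onee_eq0.
Qed.

Variable P : probability X R.
Hypothesis iT : invariant_measure T P.

Lemma invariant_iter n : invariant_measure (iter n T) P.
Proof.
elim: n => // n IHn A mA; rewrite (_ : iter n.+1 T = T \o iter n T)//.
rewrite comp_preimage IHn ?iT//.
by rewrite -[X in measurable X]setTI; exact: mT.
Qed.

Lemma entropy_iter (I : countType) (f : X -> I) n :
  code f -> entropy P (f \o iter n T) = entropy P f.
Proof.
move=> mf; rewrite /entropy -[RHS](cond_entropy_invariant (invariant_iter n))//.
exact: code_cst.
Qed.

Lemma entropy_pair_le (I J : countType) (f : X -> I) (g : X -> J) :
  code f -> code g -> (entropy P (pair_code f g) <= entropy P f + entropy P g)%E.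
Proof.
move=> mf mg; apply: le_trans (entropy_pair _ mf mg) _.
by rewrite leeD2l// cond_entropy_le_entropy.
Qed.

Lemma entropy_comp_le (I J : countType) (f : X -> I) (phi : I -> J) :
  code f -> (entropy P (phi \o f) <= entropy P f)%E.
Proof. by move=> mf; apply: cond_entropy_comp_le => //; exact: code_cst. Qed.

(** Cut the word after [m] letters; by invariance the second piece has the entropy of a word of
    length [n] started at time 0. *)
Lemma entropy_word_addn (I : countType) (f : X -> I) m n : code f ->
  (entropy P (word f (m + n)) <= entropy P (word f m) + entropy P (word f n))%E.
Proof.
move=> mf.
rewrite -(entropy_iter m (code_word n mf)).
have mw : code (word f n \o iter m T) by apply: code_iter; exact: code_word.
apply: le_trans (entropy_pair_le (code_word m mf) mw).
rewrite (_ : word f (m + n) = (fun k => k.1 ++ k.2) \o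
    pair_code (word f m) (word f n \o iter m T)); last first.
  by apply/funext => x; rewrite word_addn.
by apply: entropy_comp_le; apply: code_pair => //; exact: code_word.
Qed.

(** By the chain rule each new letter of [h] adds one conditional entropy. It is at most H(h | g),
    because the condition contains the letter of [g] at the same time. *)
Lemma cond_entropy_word (I J : countType) (h : X -> I) (g : X -> J) n :
  code h -> code g ->
  (cond_entropy P (word h n) (word g n) <= n%:R%:E * cond_entropy P h g)%E.
Proof.
move=> mh mg; elim: n => [|n IHn].
  rewrite mul0e (_ : word h 0 = (fun=> [::]) \o word g 0) ?cond_entropy_self//.
have mwh := code_word n mh; have mwg := code_word n.+1 mg.
have mhn := code_iter n mh.
rewrite (_ : word h n.+1 = (fun k => rcons k.1 k.2) \o
    pair_code (word h n) (h \o iter n T)); last first.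
  by apply/funext => x; rewrite wordSr.
apply: le_trans (cond_entropy_comp_le _ _ mwg _) _; first exact: code_pair.
rewrite cond_entropy_pair// -natr1 EFinD ge0_muleDl// mul1e.
apply: leeD; last first.
  rewrite -(cond_entropy_invariant (invariant_iter n) mh mg).
  have [x0 _] := probability_inhabited P.
  (* The default [g x0] is never returned on the words in play, which have [n.+1] letters. *)
  pose phi (k : seq I * seq J) := last (g x0) k.2.
  rewrite (_ : g \o iter n T = phi \o pair_code (word h n) (word g n.+1)).
    by apply: cond_entropy_le_comp => //; exact: code_pair.
  by apply/funext => x; rewrite -[LHS](last_rcons (g x0) (word g n x)) -wordSr.
apply: le_trans IHn.
rewrite [leRHS](_ : _ = cond_entropy P (word h n) (take n \o word g n.+1)).
  exact: cond_entropy_le_comp.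
congr cond_entropy; apply/funext => x.
by rewrite [RHS]/comp wordSr -cats1 take_size_cat// size_word.
Qed.

End Words.

(** * Approximation of events in measure *)

Section Approximation.
Context {d : measure_display} {X : measurableType d} {R : realType}.
Variable P : probability X R.

Lemma measurable_setY (A B : set X) :
  measurable A -> measurable B -> measurable (A `+` B).
Proof. by move=> mA mB; apply: measurableU; exact: measurableD. Qed.

Lemma pr_setI_le (A B : set X) :
  measurable A -> measurable B -> pr P (A `&` B) <= pr P B.
Proof. by move=> mA mB; rewrite le_pr//; exact: measurableI. Qed.

Lemma pr_setY_triangle (A B C : set X) :
  measurable A -> measurable B -> measurable C ->
  pr P (A `+` C) <= pr P (A `+` B) + pr P (B `+` C).
Proof.
move=> mA mB mC; apply: le_trans (prU _ _ _); try exact: measurable_setY.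
rewrite le_pr//; [exact: measurable_setY|by apply: measurableU; exact: measurable_setY|].
by move=> x /= [[Ax nCx]|[Cx nAx]]; have [Bx|nBx] := pselect (B x); tauto.
Qed.

Lemma pr_setY_setU (A A' B B' : set X) :
  measurable A -> measurable A' -> measurable B -> measurable B' ->
  pr P ((A `|` A') `+` (B `|` B')) <= pr P (A `+` B) + pr P (A' `+` B').
Proof.
move=> mA mA' mB mB'; apply: le_trans (prU _ _ _); try exact: measurable_setY.
rewrite le_pr//.
- by apply: measurable_setY; exact: measurableU.
- by apply: measurableU; exact: measurable_setY.
- by move=> x /=; tauto.
Qed.

(** Continuity from above: the remainders after the finite unions decrease to the empty set. *)
Lemma pr_bigcup_tail (A : nat -> set X) (e : R) :
  (forall n, measurable (A n)) -> 0 < e ->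
  exists n, pr P ((\bigcup_n A n) `+` \big[setU/set0]_(i < n) A i) <= e.
Proof.
move=> mA e0; pose U n := \big[setU/set0]_(i < n) A i.
have mU n : measurable (U n) by exact: bigsetU_measurable.
have mAA : measurable (\bigcup_n A n) by exact: bigcupT_measurable.
have mF n : measurable ((\bigcup_n A n) `\` U n) by exact: measurableD.
have capF : \bigcap_n ((\bigcup_n A n) `\` U n) = set0.
  rewrite -subset0 => x Fx; have [[n _ Anx] _] := Fx 0%N I.
  have [_] := Fx n.+1 I; apply; rewrite /U -bigcup_mkord; exists n => //=.
have cvgF : P ((\bigcup_n A n) `\` U n) @[n --> \oo] --> 0%E.
  rewrite -(measure0 P) -capF; apply: nonincreasing_cvg_mu => //.
  - by rewrite -ge0_fin_numE// fin_num_measure.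
  - by rewrite capF.
  - move=> m n mn; rewrite subsetEset; apply: setDS; rewrite /U -!bigcup_mkord => x [i /= im Aix].
    by exists i => //=; exact: leq_trans im mn.
have /fine_cvgP[_ /cvgrPdist_le/(_ e e0)[n _ /(_ n (leqnn n))]] := cvgF.
rewrite /= sub0r normrN ger0_norm ?fine_ge0// => le_e; exists n.
apply: le_trans le_e; rewrite le_pr//; first exact: (measurable_setY mAA (mU n)).
move=> x [[Ax nUx]|[Ux nAx]]; first by split.
exfalso; apply: nAx; move: Ux.
by rewrite /U -bigcup_mkord => -[i _ Aix]; exists i.
Qed.

(** The log-sum inequality merges the atoms labelled in [B] into one and the others into another. On
    the first, [psi m c] is at most c - m; on the second, m is at most the symmetric difference and
    [psi m c] is at most [psi m 1], which [psi_le_sqrt] controls. *)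
Lemma event_cond_entropy_le (J : countType) (E : set X) (g : X -> J) (B : set J) :
  measurable E -> code g ->
  (\esum_(b in setT)
     (psi (pr P (E `&` g @^-1` [set b])) (pr P (g @^-1` [set b])))%:E <=
   (pr P (E `+` g @^-1` B) + 2 * Num.sqrt (pr P (E `+` g @^-1` B)))%:E)%E.
Proof.
move=> mE mg; have mB : measurable (g @^-1` B) by exact: code_preimage.
have mB' : measurable (g @^-1` (~` B)) by exact: code_preimage.
have mEB : measurable (E `+` g @^-1` B) by exact: measurable_setY.
have le_b b : 0 <= pr P (E `&` g @^-1` [set b]) <= pr P (g @^-1` [set b]).
  by rewrite pr_ge0 pr_setI_le.
have sum_le D : (\esum_(b in D) (psi (pr P (E `&` g @^-1` [set b]))
    (pr P (g @^-1` [set b])))%:E <= (psi (pr P (E `&` g @^-1` D)) (pr P (g @^-1` D)))%:E)%E.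
  have mD : measurable (g @^-1` D) by exact: code_preimage.
  apply: log_sum => //.
  - by rewrite pr_esum// prE//; exact: measurableI.
  - by rewrite pr_esumT// prE.
rewrite (esumID B) => [|b _]; last by rewrite lee_fin psi_ge0.
rewrite !setTI EFinD; apply: leeD; apply: (le_trans (sum_le _)); rewrite lee_fin.
- set m := pr P (E `&` _); set c := pr P (g @^-1` B).
  have m0 : 0 <= m by exact: pr_ge0.
  have mc : m <= c by rewrite pr_setI_le.
  have cY : c <= m + pr P (E `+` g @^-1` B).
    apply: le_trans (prU _ _ _) => //; last exact: measurableI.
    rewrite le_pr//; first by apply: measurableU => //; exact: measurableI.
    by move=> x /= Bx; have [Ex|nEx] := pselect (E x); tauto.
  have [me|m_neq0] := eqVneq m 0; first by rewrite me psi0 pr_ge0.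
  have m_gt0 : 0 < m by rewrite lt0r m_neq0.
  (* With M = C = m the tangent bound reads psi m c + m <= c. *)
  have := psi_tangent m0 mc m_gt0 m_gt0.
  by rewrite divff// ln1 mulr0 mulr1 add0r; lra.
- set m := pr P (E `&` _); set c := pr P (g @^-1` _).
  have m0 : 0 <= m by exact: pr_ge0.
  have mc : m <= c by rewrite pr_setI_le.
  have c1 : c <= 1 by exact: pr_le1.
  have mY : m <= pr P (E `+` g @^-1` B).
    by rewrite le_pr//; [exact: measurableI|move=> x /= []; tauto].
  apply: (@le_trans _ _ (psi m 1)).
    rewrite (psi_chain m0 mc c1) lerDr mulr_ge0//.
    have [c0|c_neq0] := eqVneq c 0; first by rewrite c0 invr0 mulr0 ln0.
    have c_gt0 : 0 < c by rewrite lt0r c_neq0 (le_trans m0).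
    by rewrite ln_ge0// ler_pdivlMr// mul1r.
  apply: (le_trans (psi_le_sqrt m0)).
  by rewrite ler_pM2l// ler_wsqrtr.
Qed.

Lemma entropyE (I : countType) (f : X -> I) : code f ->
  entropy P f = (\esum_(a in setT) (psi (pr P (f @^-1` [set a])) 1)%:E)%E.
Proof.
move=> mf; rewrite /entropy cond_entropyE//; last exact: code_cst.
have -> : [set: unit] = [set tt] by apply/seteqP; split => -[].
apply: eq_esum => a _.
have e : (fun=> tt) @^-1` [set tt] = [set: X] by apply/seteqP; split.
rewrite esum_set1; first by rewrite e setIT pr_setT.
by rewrite lee_fin e setIT pr_setT psi_ge0// pr_ge0 pr_le1.
Qed.

End Approximation.

(** * Two-sided windows and approximation by a generator *)

Lemma iter_can (A : Type) (f g : A -> A) n :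
  cancel f g -> cancel (iter n f) (iter n g).
Proof. by move=> fK; elim: n => // n IHn x; rewrite iterSr iterS fK IHn. Qed.

Section Generator.
Context {d : measure_display} {X : measurableType d} {R : realType}.
Variables (T S : X -> X).
Hypotheses (mT : measurable_fun setT T) (mS : measurable_fun setT S).
Hypotheses (TK : cancel T S) (SK : cancel S T).

(* The window of [f] at [x] lists [f (T^i x)] for [-N <= i <= N]. *)
Definition window (I : Type) (f : X -> I) (N : nat) : X -> seq I :=
  word T f (N + N).+1 \o iter N S.

Lemma code_window (I : countType) (f : X -> I) N : code f -> code (window f N).
Proof. by move=> mf; apply: (code_iter mS); exact: code_word. Qed.

Lemma window_widen (I : Type) (f : X -> I) N M : (N <= M)%N ->
  window f N = (fun s => take (N + N).+1 (drop (M - N) s)) \o window f M.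
Proof.
move=> NM; apply/funext => x; rewrite /window /=.
have -> : (M + M).+1 = (M - N + ((N + N).+1 + (M - N)))%N by lia.
rewrite word_addn drop_size_cat ?size_word// word_addn take_size_cat ?size_word//.
by rewrite -{2}(subnK NM) iterD (iter_can _ SK).
Qed.

Variable P : probability X R.

Section Approximable.
Variables (I : countType) (f : X -> I).
Hypothesis mf : code f.

Definition approximable (A : set X) : Prop := measurable A /\
  forall e : R, 0 < e -> exists N B, pr P (A `+` window f N @^-1` B) <= e.

Let mW N B : measurable (window f N @^-1` B).
Proof. by apply: code_preimage; exact: code_window. Qed.

Lemma approximable_widen A e N B M : pr P (A `+` window f N @^-1` B) <= e ->
  (N <= M)%N -> exists B', pr P (A `+` window f M @^-1` B') <= e.
Proof.
move=> le_e NM; exists ((fun s => take (N + N).+1 (drop (M - N) s)) @^-1` B).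
by rewrite -comp_preimage -window_widen.
Qed.

Lemma approximable_window A N B : A = window f N @^-1` B -> approximable A.
Proof.
move=> ->; split => // e e0; exists N, B.
by rewrite setYK /pr measure0 ltW.
Qed.

Lemma approximableU A A' : approximable A -> approximable A' ->
  approximable (A `|` A').
Proof.
move=> [mA aA] [mA' aA']; split; first exact: measurableU.
move=> e e0; have e20 : 0 < e / 2 by rewrite divr_gt0.
have [N [B le_e]] := aA _ e20; have [N' [B' le_e']] := aA' _ e20.
have [C leC] := approximable_widen le_e (leq_maxl N N').
have [C' leC'] := approximable_widen le_e' (leq_maxr N N').
exists (maxn N N'), (C `|` C'); rewrite preimage_setU.
by apply: le_trans (pr_setY_setU _ _ _ _ _) _ => //; lra.
Qed.

Lemma approximable_lim A : measurable A ->
  (forall e : R, 0 < e -> exists2 A', approximable A' & pr P (A `+` A') <= e) ->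
  approximable A.
Proof.
move=> mA lim; split => // e e0; have e20 : 0 < e / 2 by rewrite divr_gt0.
have [A' [mA' aA'] leA'] := lim _ e20; have [N [B leB]] := aA' _ e20.
exists N, B; apply: le_trans (pr_setY_triangle _ mA mA' (mW N B)) _; lra.
Qed.

(** Complements keep the same symmetric difference. A countable union is close in measure to a
    finite one, whose members can be read in a common, wider window. *)
Lemma approximable_sigma_algebra : sigma_algebra setT approximable.
Proof.
have a0 : approximable set0 by apply: (@approximable_window _ 0 set0); rewrite preimage_set0.
split => // [A [mA aA]|A aA].
  split; first exact: measurableD.
  move=> e e0; have [N [B leB]] := aA e e0; exists N, (~` B).
  apply: le_trans leB; rewrite le_pr//.
  - by apply: measurable_setY => //; exact: measurableD.
  - exact: measurable_setY.
  - by move=> x /=; have [Ax|nAx] := pselect (A x); have [Bx|nBx] := pselect (B (window f N x)); tauto.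
have mA n : measurable (A n) by have [] := aA n.
apply: approximable_lim; first exact: bigcupT_measurable.
move=> e e0; have [n le_n] := pr_bigcup_tail P mA e0.
exists (\big[setU/set0]_(i < n) A i) => //.
by elim/big_ind: _ => //; exact: approximableU.
Qed.

Definition atoms (J : Type) (g : X -> J) : set (set X) :=
  [set g @^-1` [set k] | k in setT] `\ set0.

(** Membership is decided by one letter of a window: the first one for a forward image, the last one
    for a preimage. *)
Lemma approximable_shift i A :
  partition_shift T i (atoms f) A -> approximable A.
Proof.
case: i => n [_ [[k _ <-] _] <-] {A}.
- have -> : iter n T @` (f @^-1` [set k]) = (f \o iter n S) @^-1` [set k].
    apply/seteqP; split => [_ [x /= <- <-]|x /= fx]; first by rewrite (iter_can _ TK).
    by exists (iter n S x) => //; rewrite (iter_can _ SK).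
  apply: (@approximable_window _ n [set s | ohead s = Some k]).
  have e x : ohead (window f n x) = Some (f (iter n S x)) by [].
  by apply/seteqP; split => x; rewrite /preimage /mkset e; [move=> <-|case].
- apply: (@approximable_window _ n.+1 [set s | exists t, drop (n.+1 + n.+1) s = k :: t]).
  have e x : drop (n.+1 + n.+1) (window f n.+1 x) = [:: f (iter n.+1 T x)].
    rewrite /window /comp -[(n.+1 + n.+1).+1]addn1 word_addn drop_size_cat ?size_word// iterD.
    by rewrite (iter_can _ SK) /word.
  apply/seteqP; split => x; rewrite /preimage /mkset e; first by move=> <-; exists [::].
  by move=> [t []].
Qed.

Lemma generating_approximable A : generating_partition T P (atoms f) ->
  measurable A -> approximable A.
Proof.
move=> gen mA; have [C [GC PC]] := gen A mA.
have aC : approximable C.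
  move: GC; apply: smallest_sub; first exact: approximable_sigma_algebra.
  by move=> B [i _]; exact: approximable_shift.
by apply: approximable_lim => // e e0; exists C => //; rewrite /pr PC ltW.
Qed.

(** Dominated convergence by hand. The tail of the sum over labels of [h] is bounded by the tail of
    the finite entropy of [h], uniformly in the window; the remaining finitely many terms become
    small as the window grows. *)
Lemma generating_cond_entropy (h : X -> nat) (e : R) :
  generating_partition T P (atoms f) ->
  code h -> (entropy P h < +oo)%E -> 0 < e ->
  exists N, (cond_entropy P h (window f N) <= e%:E)%E.
Proof.
move=> gen mh Hh e0; have e20 : 0 < e / 2 by rewrite divr_gt0.
pose L N a : \bar R := (\esum_(b in setT)
  (psi (pr P (h @^-1` [set a] `&` window f N @^-1` [set b]))
       (pr P (window f N @^-1` [set b])))%:E)%E.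
pose H a : \bar R := (psi (pr P (h @^-1` [set a])) 1)%:E.
have mw N : code (window f N) by exact: code_window.
have le_psi N a b : 0 <= pr P (h @^-1` [set a] `&` window f N @^-1` [set b])
    <= pr P (window f N @^-1` [set b]).
  by rewrite pr_ge0 pr_setI_le.
have L0 N a : (0 <= L N a)%E by apply: esum_ge0 => b _; rewrite lee_fin psi_ge0.
have H0 a : (0 <= H a)%E by rewrite lee_fin psi_ge0// pr_ge0 pr_le1.
have LH N a : (L N a <= H a)%E.
  apply: log_sum => //.
  - by rewrite pr_esum// preimage_setT setIT prE.
  - by rewrite pr_esumT// preimage_setT probability_setT.
(* [L M a] tends to [0] for each [a] and is dominated by the summable [H a]. *)
have L_small a (r : R) : 0 < r -> exists N, forall M, (N <= M)%N -> (L M a <= r%:E)%E.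
  (* If y <= t^2 with t <= 1, then y + 2 sqrt y <= t^2 + 2 t <= 3 t <= r. *)
  move=> r0; pose t := Num.min 1 (r / 3).
  have t0 : 0 < t by rewrite lt_min ltr01 divr_gt0.
  have [_ /(_ (t ^+ 2))[|N [B leB]]] := generating_approximable gen (mh a).
    by rewrite exprn_gt0.
  exists N => M NM; have [B' leB'] := approximable_widen leB NM.
  apply: le_trans (event_cond_entropy_le _ B' (mh a) (mw M)) _; rewrite lee_fin.
  set y := pr P _ in leB' *.
  have sy : Num.sqrt y <= t by rewrite -[leRHS](ger0_norm (ltW t0)) -sqrtr_sqr ler_wsqrtr.
  have t1 : t <= 1 by rewrite ge_min lexx.
  have tr : t <= r / 3 by rewrite ge_min lexx orbT.
  have := ler_piMr (ltW t0) t1; rewrite -expr2; lra.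
have sum_small K (r : R) : 0 < r ->
    exists N, forall M, (N <= M)%N -> (\sum_(0 <= a < K) L M a <= r%:E)%E.
  elim: K r => [|K IHK] r r0; first by exists 0%N => M _; rewrite big_nil lee_fin ltW.
  have r20 : 0 < r / 2 by rewrite divr_gt0.
  have [N leN] := IHK _ r20; have [N' leN'] := L_small K _ r20.
  exists (maxn N N') => M; rewrite geq_max => /andP[NM N'M].
  rewrite big_nat_recr//= (_ : r = r / 2 + r / 2); last lra.
  by rewrite EFinD; apply: leeD; [exact: leN|exact: leN'].
have H_fin : (\sum_(0 <= a <oo) H a < +oo)%E by rewrite nneseries_esumT// -entropyE.
have /fine_cvgP[Hnum /cvgrPdist_le/(_ _ e20) Hsmall] := nneseries_tail_cvg H_fin (fun a _ => H0 a).
have [K _ /(_ K (leqnn K)) [/= HKnum HK]] := filterI Hnum Hsmall.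
have [N leN] := sum_small K _ e20.
exists N; rewrite cond_entropyE// -nneseries_esumT; last exact: L0.
rewrite (nneseries_split 0 K) => [|a _]; last exact: L0.
rewrite add0n (_ : e = e / 2 + e / 2); last lra.
rewrite EFinD; apply: leeD; first exact: leN.
apply: (@le_trans _ _ (\sum_(K <= a <oo) H a)%E); first by apply: lee_nneseries => [a _ _|a _]; [exact: L0|exact: LH].
rewrite -(fineK HKnum) lee_fin; apply: le_trans HK.
by rewrite sub0r normrN ler_norm.
Qed.

End Approximable.
End Generator.

(** * Fekete's subadditive lemma *)

Section Fekete.
Context {R : realType}.
Variable a : nat -> R.
Hypothesis a_sub : forall m n, a (m + n)%N <= a m + a n.
Hypothesis a_ge0 : forall n, 0 <= a n.

(** Divide [m] by [k]: the quotient is at most m / k, and the sum of [a] over all possible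
    remainders serves as the constant. *)
Lemma subadditive_division k : (0 < k)%N ->
  exists C, forall m, a m <= m%:R * (k%:R^-1 * a k) + C.
Proof.
move=> k0; exists (\sum_(i < k) a i) => m.
have aqs q s : a (q * k + s)%N <= q%:R * a k + a s.
  elim: q => [|q IHq]; first by rewrite mul0r add0r.
  rewrite mulSn -addnA -natr1 mulrDl mul1r; apply: le_trans (a_sub _ _) _.
  by rewrite addrC addrAC lerD2r.
rewrite {1}(divn_eq m k); apply: le_trans (aqs _ _) _; apply: lerD.
  rewrite mulrA ler_wpM2r// ler_pdivlMr ?ltr0n// -natrM ler_nat.
  exact: leq_divM.
rewrite (bigD1 (Ordinal (ltn_pmod m k0)))//= lerDl.
by apply: sumr_ge0 => i _.
Qed.

(** The limit is the infimum of the averages, which is why it lies below each of them. *)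
Lemma fekete : exists l : R, n%:R^-1 * a n @[n --> \oo] --> l /\
  forall k, (0 < k)%N -> l <= k%:R^-1 * a k.
Proof.
pose E := [set k%:R^-1 * a k | k in [set k | (0 < k)%N]].
have infE : has_inf E.
  split; first by exists (1%:R^-1 * a 1), 1%N.
  by exists 0 => _ [k _ <-]; rewrite mulr_ge0 ?invr_ge0.
have infP k : (0 < k)%N -> inf E <= k%:R^-1 * a k.
  by move=> k0; apply: ge_inf; [case: infE|exists k].
exists (inf E); split => //.
apply/cvgrPdist_le => e e0; have e20 : 0 < e / 2 by rewrite divr_gt0.
have [_ [k k0 <-] ltk] := inf_adherent e20 infE.
have [C leC] := subadditive_division k0.
near=> n.
have n0 : (0 < n)%N by near: n; exists 1%N.
have n0R : 0 < n%:R :> R by rewrite ltr0n.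
have Cn : C / n%:R <= e / 2.
  rewrite ler_pdivrMr// mulrC -ler_pdivrMr//.
  by near: n; exact: nbhs_infty_ger.
rewrite distrC ger0_norm ?subr_ge0 ?infP// lerBlDl.
have : n%:R^-1 * a n <= k%:R^-1 * a k + C / n%:R.
  rewrite -(ler_pM2l n0R) mulrA divff ?gt_eqF// mul1r mulrDr.
  by rewrite [n%:R * (C / _)]mulrC divfK ?gt_eqF.
lra.
Unshelve. all: by end_near. Qed.

End Fekete.

(** * Entropy rates and comparison with a generator *)

Section KolmogorovSinai.
Context {d : measure_display} {X : measurableType d} {R : realType}.
Variables (T S : X -> X).
Hypotheses (mT : measurable_fun setT T) (mS : measurable_fun setT S).
Hypotheses (TK : cancel T S) (SK : cancel S T).
Variable P : probability X R.
Hypothesis iT : invariant_measure T P.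

Lemma invariant_inverse : invariant_measure S P.
Proof.
move=> A mA; rewrite -iT; last by rewrite -[X in measurable X]setTI; exact: mS.
by rewrite -comp_preimage (_ : S \o T = id)//; apply/funext.
Qed.

Lemma entropy_le_cond (I J : countType) (f : X -> I) (g : X -> J) :
  code f -> code g -> (entropy P f <= entropy P g + cond_entropy P f g)%E.
Proof.
move=> mf mg; apply: le_trans (entropy_pair P mg mf).
exact: (entropy_comp_le P snd (code_pair mg mf)).
Qed.

Lemma entropy_ge0 (I : countType) (f : X -> I) : code f -> (0 <= entropy P f)%E.
Proof. by move=> mf; apply: cond_entropy_ge0 => //; exact: code_cst. Qed.

Lemma entropy_word_fin (I : countType) (f : X -> I) n :
  code f -> (entropy P f < +oo)%E -> entropy P (word T f n) \is a fin_num.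
Proof.
move=> mf Hf; rewrite ge0_fin_numE; last exact/entropy_ge0/code_word.
elim: n => [|n IHn].
  rewrite (_ : word T f 0 = (fun=> [::]) \o (fun=> tt))//.
  by rewrite /entropy cond_entropy_self.
rewrite (_ : word T f n.+1 = (fun k => rcons k.1 k.2) \o
    pair_code (word T f n) (f \o iter n T)); last first.
  by apply/funext => x; rewrite wordSr.
have mw : code (word T f n) by exact: code_word.
have mfn : code (f \o iter n T) by exact: code_iter.
apply: le_lt_trans (entropy_comp_le _ _ (code_pair mw mfn)) _.
apply: le_lt_trans (entropy_pair_le _ mw mfn) _.
by rewrite entropy_iter// lte_add_pinfty.
Qed.

Lemma entropy_rate (I : countType) (f : X -> I) :
  code f -> (entropy P f < +oo)%E ->
  exists l : R, n%:R^-1 * fine (entropy P (word T f n)) @[n --> \oo] --> l /\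
  forall k, (0 < k)%N -> l <= k%:R^-1 * fine (entropy P (word T f k)).
Proof.
move=> mf Hf; apply: fekete => [m n|n]; last exact/fine_ge0/entropy_ge0/code_word.
rewrite -fineD ?entropy_word_fin// fine_le ?fin_numD ?entropy_word_fin//.
exact: entropy_word_addn.
Qed.

(** Consecutive windows overlap, so [n] of them are read off one word of n + 2N letters started N
    steps in the past; invariance under the inverse removes this time shift. *)
Lemma entropy_word_window (I : countType) (f : X -> I) N n : code f ->
  (entropy P (word T (window T S f N) n) <= entropy P (word T f (n + (N + N))))%E.
Proof.
move=> mf.
rewrite -(entropy_iter mS invariant_inverse N (code_word mT _ mf)).
pose phi (s : seq I) := [seq take (N + N).+1 (drop i s) | i <- iota 0 n].
rewrite (_ : word T (window T S f N) n = phi \o (word T f (n + (N + N)) \o iter N S)).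
  by apply: entropy_comp_le; apply: (code_iter mS); exact: code_word.
apply/funext => x; rewrite /phi /comp [LHS]/word; apply/eq_in_map => i.
rewrite mem_iota add0n /= => ltin.
(* The window at time i occupies positions i to i + 2N of the long word, and n - i - 1 letters
   follow it. *)
have -> : (n + (N + N) = i + ((N + N).+1 + (n - i.+1)))%N by lia.
rewrite [in RHS]word_addn drop_size_cat ?size_word//.
rewrite [in RHS]word_addn take_size_cat ?size_word//; congr word.
(* What remains is that the iterates of [T] and [S] commute. *)
clear phi; elim: i {ltin} => // i IHi.
rewrite [RHS]iterS -IHi iterS.
by elim: N {IHi} (iter i T x) => // N IHN y; rewrite !iterSr TK -IHN SK.
Qed.

(** For a window with H(h | window) <= e, the word of [h] of length n has entropy at most that of
    the [f]-word of length n, plus that of the [f]-word of length 2N, plus n e. Divide by n; the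
    middle term disappears in the limit. *)
Lemma generator_entropy_rate_le (I : countType) (f : X -> I) (h : X -> nat) (lf lh : R) :
  code f -> code h -> (entropy P f < +oo)%E -> (entropy P h < +oo)%E ->
  generating_partition T P (atoms f) ->
  n%:R^-1 * fine (entropy P (word T f n)) @[n --> \oo] --> lf ->
  n%:R^-1 * fine (entropy P (word T h n)) @[n --> \oo] --> lh ->
  lh <= lf.
Proof.
move=> mf mh Hf Hh gen cf ch; apply/ler_addgt0Pr => e e0.
have [N leN] := generating_cond_entropy mT mS TK SK mf gen mh Hh e0.
pose a (J : countType) (g : X -> J) n := fine (entropy P (word T g n)).
have c2 : n%:R^-1 * a _ f n + n%:R^-1 * a _ f (N + N)%N + e @[n --> \oo] --> lf + 0 + e.
  apply: cvgD; last exact: cvg_cst.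
  apply: cvgD => //; rewrite -(mul0r (a _ f (N + N)%N)); apply: cvgMl.
  apply/gtr0_cvgV0; last exact: cvgr_idn.
  by near=> n; rewrite ltr0n; near: n; exists 1%N.
rewrite -(addr0 lf); apply: (ler_cvg_to ch c2).
near=> n.
have n0 : 0 < n%:R :> R by rewrite ltr0n; near: n; exists 1%N.
rewrite -(ler_pM2l n0) !mulrDr !mulrA divff ?gt_eqF// !mul1r.
have mw : code (window T S f N) by exact: code_window.
rewrite /a -lee_fin !EFinD !fineK ?entropy_word_fin//.
apply: le_trans (entropy_le_cond (code_word mT _ mh) (code_word mT n mw)) _.
apply: leeD.
  apply: le_trans (entropy_word_window _ _ mf) _.
  exact: entropy_word_addn.
apply: le_trans (cond_entropy_word mT iT n mh mw) _.
by rewrite EFinM lee_pmul2l.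
Unshelve. all: by end_near. Qed.

End KolmogorovSinai.

(** * Translation between partitions and labellings *)

Section Atoms.
Context {d : measure_display} {X : measurableType d} {R : realType}.

Lemma partition_entropy_atoms (P : probability X R) (I : countType) (f : X -> I) :
  code f -> partition_entropy P (atoms f) = entropy P f.
Proof.
move=> mf; rewrite entropyE//.
pose D := [set k | f @^-1` [set k] !=set0].
have -> : atoms f = [set f @^-1` [set k] | k in D].
  apply/seteqP; split => A /=.
    by move=> [[k _ <-] /eqP/set0P ne]; exists k.
  by move=> [k Dk <-]; split; [exists k|apply/eqP/set0P].
rewrite /partition_entropy esum_image; last first.
  move=> k k' /set_mem [x fx] _ e; rewrite /= in fx; rewrite -fx.
  suff: (f @^-1` [set k']) x by [].
  by rewrite -e.
rewrite esum_mkcond; apply: eq_esum => k _; case: ifPn => [_|nDk].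
  rewrite /psi div1r -/(pr P (f @^-1` [set k])); set p := pr P _.
  have : 0 <= p by exact: pr_ge0.
  rewrite le_eqVlt => /predU1P[<-|p0]; first by rewrite !mul0r oppr0.
  by rewrite lnV ?posrE// mulrN.
rewrite (_ : f @^-1` [set k] = set0) ?/pr ?measure0 ?psi0//.
by rewrite -subset0 => x fx; move/negP: nDk; apply; apply/mem_set; exists x.
Qed.

Lemma partition_join_atoms (I J : Type) (f : X -> I) (g : X -> J) :
  partition_join (atoms f) (atoms g) = atoms (pair_code f g).
Proof.
apply/seteqP; split => A /=.
  move=> [[_ [[a _ <-] _] [_ [[b _ <-] _] <-]] ne0]; split => //.
  by exists (a, b) => //; rewrite pair_code_preimage.
move=> [[[a b] _ <-]]; rewrite pair_code_preimage/= => ne0; split => //.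
have [x [fx gx]] : f @^-1` [set a] `&` g @^-1` [set b] !=set0 by apply/set0P/eqP.
exists (f @^-1` [set a]); first by split; [exists a|apply/eqP/set0P; exists x].
by exists (g @^-1` [set b]) => //; split; [exists b|apply/eqP/set0P; exists x].
Qed.

Lemma atoms_comp_inj (I J : Type) (f : X -> I) (phi : I -> J) :
  injective phi -> atoms (phi \o f) = atoms f.
Proof.
move=> phiI; apply/seteqP; split => A /=; last first.
  move=> [[k _ <-] ne0]; split => //; exists (phi k) => //.
  by apply/seteqP; split => x /= => [/phiI|->].
move=> [[k _ <-] /eqP/set0P[x /= fxk]]; split; last by apply/eqP/set0P; exists x.
exists (f x) => //; apply/seteqP; split => y /=; first by move=> ->.
by rewrite -fxk; exact: phiI.
Qed.

Lemma partition_shift_atoms (T S : X -> X) (I : Type) (f : X -> I) (n : nat) :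
  cancel S T -> partition_shift T (- n%:Z) (atoms f) = atoms (f \o iter n T).
Proof.
move=> SK; have iterT (y : X) : exists x, iter n T x = y.
  by exists (iter n S y); rewrite (iter_can _ SK).
have -> : partition_shift T (- n%:Z) (atoms f) = [set iter n T @^-1` A | A in atoms f].
  (* At n = 0 the shift is an image under the identity; for all other n it is a preimage by
     definition. *)
  by case: n {iterT} => // /=; apply/seteqP; split => A /= [B Bf <-]; exists B => //; rewrite image_id.
apply/seteqP; split => A /=.
  move=> [_ [[k _ <-] /eqP/set0P[y /= fyk]] <-]; split; first by exists k.
  by have [x xy] := iterT y; apply/eqP/set0P; exists x; rewrite /= xy.
move=> [[k _ <-] /eqP/set0P[x /= fxk]]; exists (f @^-1` [set k]) => //.
by split; [exists k|apply/eqP/set0P; exists (iter n T x)].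
Qed.

Lemma iterated_join_atoms (T S : X -> X) (I : Type) (f : X -> I) (n : nat) :
  [set: X] !=set0 -> cancel S T ->
  iterated_join T (atoms f) n = atoms (word T f n).
Proof.
move=> [x0 _] SK; rewrite /iterated_join.
rewrite -(big_mkord predT (fun i => partition_shift T (- i%:Z) (atoms f))).
rewrite /word /index_iota subn0; elim: (iota 0 n) => [|i s IHs].
  rewrite big_nil; apply/seteqP; split => A /=.
    by move=> ->; split; [exists [::]; [|apply/seteqP]|apply/eqP/set0P; exists x0].
  move=> [[k _ <-] /eqP/set0P[x /= <-]].
  by apply/seteqP; split.
rewrite big_cons IHs (partition_shift_atoms _ _ SK) partition_join_atoms.
rewrite -(@atoms_comp_inj _ _ _ (fun k => k.1 :: k.2))//.
by move=> [a b] [a' b'] /= [-> ->].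
Qed.

(** Label a point by the number that an injective enumeration gives to its unique atom; unattained
    numbers have empty fibres, which [atoms] discards. *)
Lemma countable_partition_atoms (eta : set (set X)) : countable_partition eta ->
  exists2 f : X -> nat, code f & eta = atoms f.
Proof.
move=> [ceta meta [cov triv ne]].
have [c cI] := countable_injP _ ceta.
have inA x : {A | eta A & A x}.
  by apply/cid2; have : [set: X] x by []; rewrite -cov => -[A etaA Ax]; exists A.
pose at_ x := s2val (inA x).
have atP x : eta (at_ x) /\ at_ x x by rewrite /at_; case: (inA x).
have at_uniq A x : eta A -> A x -> at_ x = A.
  move=> etaA Ax; have [etax xx] := atP x.
  by apply: triv => //; exists x.
pose f x := c (at_ x).
have fibre A : eta A -> f @^-1` [set c A] = A.
  move=> etaA; apply/seteqP; split => x /= => [fx|Ax]; last by rewrite /f (at_uniq A).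
  have [etax xx] := atP x.
  by have <- : at_ x = A by apply: cI; rewrite ?inE.
have fibre0 k : f @^-1` [set k] !=set0 -> exists2 A, eta A & f @^-1` [set k] = A.
  by move=> [x /= <-]; have [etax _] := atP x; exists (at_ x) => //; exact: fibre.
exists f.
  move=> k; have [/fibre0[A etaA ->]|/set0P/negP/negPn/eqP->] :=
    pselect (f @^-1` [set k] !=set0) => //; exact: meta.
apply/seteqP; split => A.
  move=> etaA; split; first by exists (c A) => //; exact: fibre.
  by apply/eqP/set0P; exact: ne.
by move=> [[k _ <-] /eqP/set0P/fibre0[B etaB ->]].
Qed.

End Atoms.

(** * The Kolmogorov-Sinai bound for a generator *)

Section Rate.
Context {d : measure_display} {X : measurableType d} {R : realType}.
Variables (T S : X -> X).
Hypotheses (mT : measurable_fun setT T) (mS : measurable_fun setT S).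
Hypotheses (TK : cancel T S) (SK : cancel S T).
Variable P : probability X R.
Hypothesis iT : invariant_measure T P.

Lemma entropy_wrt_atoms (I : countType) (f : X -> I) (l : R) :
  code f -> (entropy P f < +oo)%E ->
  n%:R^-1 * fine (entropy P (word T f n)) @[n --> \oo] --> l ->
  entropy_wrt P T (atoms f) = l%:E.
Proof.
move=> mf Hf cl; apply/cvg_lim => //.
rewrite (_ : (fun n => _) = (fun n => (n%:R^-1 * fine (entropy P (word T f n)))%:E)).
  by apply: cvg_EFin => //; exact: nearW.
apply/funext => n; rewrite (iterated_join_atoms _ _ (probability_inhabited P) SK).
rewrite partition_entropy_atoms; last exact: code_word.
by rewrite EFinM fineK// entropy_word_fin.
Qed.

Lemma kolmogorov_sinai (I : countType) (f : X -> I) (l : R) :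
  code f -> (entropy P f < +oo)%E -> generating_partition T P (atoms f) ->
  n%:R^-1 * fine (entropy P (word T f n)) @[n --> \oo] --> l ->
  (ks_entropy P T <= l%:E)%E.
Proof.
move=> mf Hf gen cl; apply: ge_ereal_sup => _ [eta [/countable_partition_atoms[h mh ->]]] + <-.
rewrite partition_entropy_atoms// => Hh.
have [lh [clh _]] := entropy_rate mT iT mh Hh.
rewrite (entropy_wrt_atoms mh Hh clh) lee_fin.
exact: (generator_entropy_rate_le mT mS TK SK iT mf mh Hf Hh gen cl clh).
Qed.

End Rate.

(** * Entropies of two multiplicatively close measures *)

Section Comparison.
Context {d : measure_display} {X : measurableType d} {R : realType}.
Variables (P Q : probability X R) (e : R).

(** Two-sided linear bounds, unlike an absolute value, can be summed over labels and so pass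
    directly to coarser partitions. *)
Definition close_on (I : Type) (f : X -> I) : Prop := forall k,
  (1 - e) * pr Q (f @^-1` [set k]) <= pr P (f @^-1` [set k]) <=
  (1 + e) * pr Q (f @^-1` [set k]).

Hypotheses (e_gt0 : 0 < e) (e_lt1 : e < 1).

Lemma close_on_comp (I J : countType) (f : X -> I) (phi : I -> J) :
  code f -> close_on f -> close_on (phi \o f).
Proof.
move=> mf PQ k; have mphi : measurable (f @^-1` (phi @^-1` [set k])) by exact: code_preimage.
have e0 : 0 <= 1 - e by rewrite subr_ge0 ltW.
have e0' : 0 <= 1 + e by rewrite addr_ge0 ?ltW.
rewrite comp_preimage -!lee_fin !EFinM !prE// -!pr_esumT//.
have q0 i : (0 <= (pr Q (f @^-1` [set i]))%:E)%E by rewrite lee_fin pr_ge0.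
rewrite -!esumZl//; apply/andP; split; apply: le_esum => i _; rewrite -EFinM lee_fin.
  by have /andP[] := PQ i.
by have /andP[] := PQ i.
Qed.

(** For an atom of masses p and q > 0, use 1 / q <= (1 + e) / p in the logarithm, then q <= p / (1 -
    e) in front of ln (1 / p) >= 0. The terms q ln (1 + e) sum to ln (1 + e). *)
Lemma close_on_entropy (I : countType) (f : X -> I) : code f -> close_on f ->
  (entropy Q f <= (1 - e)^-1%:E * entropy P f + (ln (1 + e))%:E)%E.
Proof.
move=> mf PQ; rewrite !entropyE//.
have e0 : 0 < 1 - e by rewrite subr_gt0.
have e1 : 0 < 1 + e by rewrite addr_gt0.
have ln0 : 0 <= ln (1 + e) by rewrite ln_ge0// lerDl ltW.
have p0 i : (0 <= (psi (pr P (f @^-1` [set i])) 1)%:E)%E.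
  by rewrite lee_fin psi_ge0// pr_ge0 pr_le1.
have q0 i : (0 <= (pr Q (f @^-1` [set i]))%:E)%E by rewrite lee_fin pr_ge0.
have -> : (ln (1 + e))%:E = (\esum_(i in setT) ((ln (1 + e))%:E * (pr Q (f @^-1` [set i]))%:E))%E.
  by rewrite esumZl// pr_esumT// preimage_setT probability_setT mule1.
rewrite -esumZl ?invr_ge0 ?(ltW e0)// -esumD; last 2 first.
- by move=> i _; rewrite mule_ge0// lee_fin invr_ge0 ltW.
- by move=> i _; rewrite mule_ge0// lee_fin.
apply: le_esum => i _; rewrite -!EFinM -EFinD lee_fin.
have /andP[] := PQ i; set p := pr P _; set q := pr Q _ => pq1 pq2.
have : 0 <= q by exact: pr_ge0.
rewrite le_eqVlt => /predU1P[<-|q_gt0].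
  by rewrite psi0 mulr0 addr0 mulr_ge0 ?invr_ge0 ?(ltW e0)// -lee_fin; exact: p0.
have p_gt0 : 0 < p by apply: lt_le_trans pq1; rewrite mulr_gt0.
have p1 : p <= 1 by exact: pr_le1.
have lp0 : 0 <= ln p^-1 by rewrite ln_ge0// invf_ge1.
rewrite /psi !div1r mulrA.
apply: (@le_trans _ _ (q * ln p^-1 + ln (1 + e) * q)); last first.
  by rewrite lerD2r ler_wpM2r// mulrC ler_pdivlMr// mulrC.
rewrite (mulrC (ln _) q) -mulrDr ler_pM2l// addrC -lnM ?posrE ?invr_gt0//.
rewrite ler_ln ?posrE ?invr_gt0 ?divr_gt0//.
by rewrite ler_pdivlMr// mulrC ler_pdivrMr.
Qed.

End Comparison.

(** * Semicontinuity of the entropy along the sequence of measures *)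

Lemma limn_esup_le {R : realType} (u : (\bar R)^nat) (c : \bar R) :
  (\forall n \near \oo, (u n <= c)%E) -> (limn_esup u <= c)%E.
Proof.
move=> [N _ uc]; rewrite limn_esup_lim (cvg_lim _ (@cvg_esups_inf _ u))//.
apply: (@le_trans _ _ (esups u N)); first by apply: ereal_inf_lbound; exists N.
by apply: ge_ereal_sup => _ [n /= Nn <-]; exact: uc.
Qed.

Lemma word_close_on {d : measure_display} {X : measurableType d} {R : realType}
    (T S : X -> X) (P Q : probability X R) (I : countType) (f : X -> I) (e : R) n :
  measurable_fun setT T -> cancel S T -> code f ->
  (forall A, iterated_join T (atoms f) n A -> (`|P A - Q A| <= e%:E * Q A)%E) ->
  close_on P Q e (word T f n).
Proof.
move=> mT SK mf PQ k; have mA : measurable (word T f n @^-1` [set k]) by exact: code_word.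
have [Ak|Ak] := eqVneq (word T f n @^-1` [set k]) set0.
  by rewrite Ak /pr !measure0 !mulr0 lexx.
have /PQ : iterated_join T (atoms f) n (word T f n @^-1` [set k]).
  by rewrite (iterated_join_atoms _ _ (probability_inhabited P) SK); split; [exists k|exact/eqP].
rewrite -!prE// -EFinB -EFinM lee_fin ler_norml => /andP[]; lra.
Qed.

Theorem theorem1 (d : measure_display) (X : measurableType d) (R : realType)
    (T : X -> X) (xi : set (set X)) (mu : probability X R)
    (mu_ : nat -> probability X R) (r : nat -> nat) (eps : nat -> R)
    (hT : measurable_automorphism T)
    (hxi : countable_partition xi)
    (hmu : invariant_measure T mu)
    (hH : (partition_entropy mu xi < +oo)%E)
    (hmu_ : forall n : nat, (1 <= n)%N -> invariant_measure T (mu_ n))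
    (heps : forall n : nat, (1 <= n)%N -> 0 < eps n)
    (hr_lim : r n @[n --> \oo] --> \oo)
    (heps_lim : eps n @[n --> \oo] --> (0 : R))
    (hclose : forall n : nat, (1 <= n)%N ->
       forall A : set X, iterated_join T xi (r n).+1 A ->
       (`|mu A - mu_ n A| <= (eps n)%:E * mu_ n A)%E)
    (hgen : generating_partition T mu xi)
    (hgen_ : forall n : nat, (1 <= n)%N -> generating_partition T (mu_ n) xi) :
  (limn_esup (fun n : nat => ks_entropy (mu_ n) T) <= ks_entropy mu T)%E.
Proof.
have [mT [S [mS TK SK]]] := hT.
have [f mf xiE] := countable_partition_atoms hxi.
move: hxi; rewrite {}xiE in hH hclose hgen hgen_ * => hxi.
have Hf : (entropy mu f < +oo)%E by rewrite -partition_entropy_atoms.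
have [l [cl _]] := entropy_rate mT hmu mf Hf.
(* The partition itself competes in the supremum defining the entropy of [mu], so it suffices to
   bound the limsup by its rate [l]. *)
apply: (@le_trans _ _ l%:E); last first.
  apply: ereal_sup_ubound; exists (atoms f) => //.
  exact: (entropy_wrt_atoms mT SK hmu).
apply/lee_addgt0Pr => e e0; rewrite -EFinD; apply: limn_esup_le.
have [k k0 lt_k] : exists2 k, (0 < k)%N &
    k%:R^-1 * fine (entropy mu (word T f k)) <= l + e / 2.
  have e20 : 0 < e / 2 by rewrite divr_gt0.
  have /cvgrPdist_le/(_ _ e20)[N _ cN] := cl.
  exists N.+1 => //; have := cN N.+1 (leqnSn N); rewrite /= ler_norml => /andP[+ _].
  by rewrite lerBrDl lerBlDr.
set A := _ * fine _ in lt_k.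
have finw n : entropy mu (word T f n) \is a fin_num by exact: (entropy_word_fin mT hmu).
have A0 : 0 <= A by rewrite mulr_ge0 ?invr_ge0// fine_ge0// entropy_ge0//; exact: code_word.
(* The final error is at most 2 A eps + eps, so this threshold keeps it below e / 2. It depends on
   [k] through [A], hence [k] is fixed before [n]. *)
have d0 : 0 < e / 2 / (2 * A + 1) by rewrite !divr_gt0// ltr_wpDl// mulr_ge0.
have r_ge : \forall m \near \oo, (k <= r m)%N by exact: (hr_lim _ (nbhs_infty_ge k)).
near=> n.
have n1 : (1 <= n)%N by near: n; exists 1%N.
have en0 := heps n n1.
have en_half : eps n <= 2^-1.
  near: n; move/cvgrPdist_le : heps_lim => /(_ 2^-1); rewrite invr_gt0 ltr0n => /(_ isT).
  by apply: filterS => m; rewrite sub0r normrN => /(le_trans (ler_norm _)).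
have en_d : eps n <= e / 2 / (2 * A + 1).
  near: n; move/cvgrPdist_le : heps_lim => /(_ _ d0).
  by apply: filterS => m; rewrite sub0r normrN => /(le_trans (ler_norm _)).
have rk : (k <= (r n).+1)%N.
  by near: n; apply: filterS r_ge => m /leqW.
have en1 : eps n < 1 by lra.
have close_n : close_on mu (mu_ n) (eps n) (word T f (r n).+1).
  exact: (word_close_on mT SK mf (hclose n n1)).
have mwr := code_word mT (r n).+1 mf.
(* Finite entropy of the partition for [mu_ n] comes from closeness on single letters. The word has
   at least one letter, so the default of [head] is never returned. *)
have Hfn : (entropy (mu_ n) f < +oo)%E.
  have close_f := close_on_comp en0 en1 (head 0%N) mwr close_n.
  apply: le_lt_trans (close_on_entropy en0 en1 mf close_f) _.
  have Hff : entropy mu f \is a fin_num by rewrite ge0_fin_numE// entropy_ge0.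
  by rewrite -(fineK Hff) -EFinM -EFinD ltry.
have wk : word T f k = take k \o word T f (r n).+1.
  by apply/funext => x /=; rewrite -[in RHS](subnKC rk) word_addn take_size_cat// size_word.
have close_k : close_on mu (mu_ n) (eps n) (word T f k).
  by rewrite wk; exact: close_on_comp.
have mwk := code_word mT k mf.
have le_k := close_on_entropy en0 en1 mwk close_k.
have iTn := hmu_ n n1.
have [ln_ [cln le_ln]] := entropy_rate mT iTn mf Hfn.
apply: le_trans (kolmogorov_sinai mT mS TK SK iTn mf Hfn (hgen_ n n1) cln) _.
rewrite lee_fin; apply: (le_trans (le_ln k k0)).
have kR : 0 < k%:R :> R by rewrite ltr0n.
have k1 : k%:R^-1 <= 1 :> R by rewrite invf_le1// ler1n.
have {}le_k : fine (entropy (mu_ n) (word T f k)) <=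
    (1 - eps n)^-1 * fine (entropy mu (word T f k)) + ln (1 + eps n).
  by rewrite -lee_fin EFinD EFinM !fineK//; exact: (entropy_word_fin mT iTn).
(* Here 1 / k <= 1 and ln (1 + eps) <= eps absorb the additive error. *)
have le_A : k%:R^-1 * fine (entropy (mu_ n) (word T f k)) <= (1 - eps n)^-1 * A + eps n.
  apply: (@le_trans _ _ (k%:R^-1 * ((1 - eps n)^-1 * fine (entropy mu (word T f k)) + ln (1 + eps n)))).
    by rewrite ler_pM2l ?invr_gt0.
  rewrite mulrDr mulrCA lerD2l; apply: (@le_trans _ _ (ln (1 + eps n))).
    by rewrite ler_piMl// ln_ge0// lerDl ltW.
  by apply: le_ln1Dx; rewrite (lt_trans _ en0)// ltrN10.
(* Since (1 + 2 t) (1 - t) = 1 + t (1 - 2 t), this holds for 0 <= t <= 1/2. *)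
have inv_le : (1 - eps n)^-1 <= 1 + 2 * eps n.
  rewrite -[leLHS]div1r ler_pdivrMr ?subr_gt0//; nra.
apply: (le_trans le_A).
have : (1 - eps n)^-1 * A <= (1 + 2 * eps n) * A by rewrite ler_wpM2r.
have : eps n * (2 * A + 1) <= e / 2.
  by rewrite -ler_pdivlMr// ltr_wpDl// mulr_ge0.
move: (A) (eps n) lt_k => a t lt_k.
rewrite mulrDr mulr1 mulrDl mul1r; move: (_^-1 * _) => b; lra.
Unshelve. all: by end_near. Qed.
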